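(* Let $-\frac{\pi}{2}<\theta<\frac{\pi}{2}$, $a\in\mathbb{R}$, and $a\neq \ln (2\cos\theta)$. Then $$\int_{-\pi/2}^{\pi/2}\frac{dx}{i(x+\theta)-a+\ln\left(2\cos x\right)}=\frac{\pi}{i\theta - a}+\frac{\pi}{1-e^{i\theta-a}}\,H\left[\ln (2\cos\theta)-a\right].$$
   Context: $H$ denotes the unit step function: $H(t)=1$ for $t>0$ and $H(t)=0$ for $t<0$.
   Formalization: At θ = a = 0 (allowed, as 0 ≠ ln 2) both terms of the right-hand side divide by zero; the equality is proved for all other (θ, a), and at (0,0) the integral is shown to exist and equal the limit of the right-hand side as (θ, a) → (0,0). *)

(* Defs.v *)
From Stdlib Require Export Reals.
From Coquelicot Require Export Coquelicot.
Open Scope R_scope.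

Definition Cexp (z : C) : C :=
  (exp (Re z) * cos (Im z), exp (Re z) * sin (Im z)).

(* Only the values at t <> 0 matter; H 0 = 0 is an arbitrary choice. *)
Definition H (t : R) : R := if Rlt_dec 0 t then 1 else 0.

Definition integrand (theta a x : R) : C :=
  (1 / (Ci * RtoC (x + theta) - RtoC a + RtoC (ln (2 * cos x))))%C.

(* Both denominators vanish exactly when theta = a = 0 (for |theta| < PI/2);
   there the totalized inverse of C makes this expression meaningless. *)
Definition closed_form (theta a : R) : C :=
  (RtoC PI / (Ci * RtoC theta - RtoC a)
   + RtoC PI / (1 - Cexp (Ci * RtoC theta - RtoC a))
     * RtoC (H (ln (2 * cos theta) - a)))%C.

(* Integral over the open interval ]l, r[, so that the junk value of ln at
   2 * cos (PI/2) = 0 is never used. *)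
Definition is_open_integral (f : R -> C) (l r : R) (I : C) : Prop :=
  is_RInt_gen (V := C_R_NormedModule) f (at_right l) (at_left r) I.

(* Main.v *)
Require Import Defs.
From Stdlib Require Import Reals Lra Psatz.
From Coquelicot Require Import Coquelicot.
Open Scope R_scope.

(** With z = e^(2ix) and c = i theta - a one has log (1 + z) = ix + ln (2 cos x),
    so the integrand is 1/w with w = log (1 + z) + c and e^w = e^c (1 + z).
    Split 1/w = phi(w) + 1/(e^w - 1).  The first term has only a removable
    singularity in the disc |z| < 1 and extends continuously to z = -1, so its
    mean over the unit circle is its value phi(c) at z = 0.  The second term is
    1/(A z + B) with A = e^c and B = e^c - 1; its mean is 0 or 1/B according to
    whether |B| < |A|, i.e. a < ln (2 cos theta), or |B| > |A|.

    The mean over the circle of radius r has zero r-derivative, because the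
    r-derivative of F(r e^(2ix)) is, up to a constant factor, its x-derivative.
    Removability of the singularity is never needed: the mean is continuous in
    r, and its derivative may be left unknown at one radius. *)

(** * Differentiation of complex-valued functions of a real variable *)

(** Componentwise, so that the complex rules below reduce to real derivatives; holomorphy enters
    only as a chain rule along such real curves. *)
Definition is_derive_C (f : R -> C) (t : R) (d : C) : Prop :=
  is_derive (fun s => fst (f s)) t (fst d) /\
  is_derive (fun s => snd (f s)) t (snd d).

Lemma is_derive_C_ext_loc (f g : R -> C) (t : R) (d : C) :
  locally t (fun s => f s = g s) -> is_derive_C f t d -> is_derive_C g t d.
Proof.
intros E [H1 H2]; split; (eapply is_derive_ext_loc; [ | eassumption]);
  (eapply filter_imp; [ | exact E]); intros s ->; reflexivity.
Qed.

Lemma is_derive_C_eq (f : R -> C) (t : R) (d d' : C) :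
  is_derive_C f t d -> d = d' -> is_derive_C f t d'.
Proof. now intros Hf <-. Qed.

Lemma is_derive_C_const (c : C) (t : R) : is_derive_C (fun _ => c) t (RtoC 0).
Proof. split; simpl; apply (is_derive_const (V := R_NormedModule)). Qed.

Lemma is_derive_C_RtoC (f : R -> R) (t d : R) :
  is_derive f t d -> is_derive_C (fun s => RtoC (f s)) t (RtoC d).
Proof.
intros Hf; split; simpl; [exact Hf | apply (is_derive_const (V := R_NormedModule))].
Qed.

Lemma is_derive_C_plus (f g : R -> C) (t : R) (df dg : C) :
  is_derive_C f t df -> is_derive_C g t dg ->
  is_derive_C (fun s => (f s + g s)%C) t (df + dg)%C.
Proof.
intros [F1 F2] [G1 G2]; split; simpl;
  apply (is_derive_plus (V := R_NormedModule)); assumption.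
Qed.

Lemma is_derive_C_mult (f g : R -> C) (t : R) (df dg : C) :
  is_derive_C f t df -> is_derive_C g t dg ->
  is_derive_C (fun s => (f s * g s)%C) t (df * g t + f t * dg)%C.
Proof.
intros [F1 F2] [G1 G2]; split; simpl.
- evar_last.
  + apply (is_derive_minus (V := R_NormedModule)).
    * apply is_derive_Reals, derivable_pt_lim_mult; apply is_derive_Reals; eassumption.
    * apply is_derive_Reals, derivable_pt_lim_mult; apply is_derive_Reals; eassumption.
  + unfold minus, plus, opp; simpl; ring.
- evar_last.
  + apply (is_derive_plus (V := R_NormedModule)).
    * apply is_derive_Reals, derivable_pt_lim_mult; apply is_derive_Reals; eassumption.
    * apply is_derive_Reals, derivable_pt_lim_mult; apply is_derive_Reals; eassumption.
  + unfold plus; simpl; ring.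
Qed.

Lemma Cnorm2_neq_0 (z : C) : z <> 0%C -> fst z ^ 2 + snd z ^ 2 <> 0.
Proof.
intros Hz E; apply Hz; destruct z as [x y]; simpl in *.
assert (x = 0) by nra; assert (y = 0) by nra; now subst.
Qed.

Lemma is_derive_C_inv (f : R -> C) (t : R) (df : C) :
  is_derive_C f t df -> f t <> 0%C ->
  is_derive_C (fun s => (/ f s)%C) t (- df / (f t * f t))%C.
Proof.
intros [F1 F2] Hn; assert (Hq := Cnorm2_neq_0 _ Hn).
assert (Hq2 := Cnorm2_neq_0 _ (Cmult_neq_0 _ _ Hn Hn)).
unfold is_derive_C, Cinv, Cdiv, Cmult, Copp in *; simpl fst in *; simpl snd in *.
(* Once [p] and [q] are opaque, [auto_derive] leaves [Derive p t] and [Derive q t], which [F1] and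
   [F2] evaluate. *)
set (p := fun s => fst (f s)) in *; set (q := fun s => snd (f s)) in *.
change (is_derive p t (fst df)) in F1; change (is_derive q t (snd df)) in F2.
change (fst (f t)) with (p t) in *; change (snd (f t)) with (q t) in *.
assert (E1 : ex_derive p t) by (eexists; exact F1).
assert (E2 : ex_derive q t) by (eexists; exact F2).
apply is_derive_unique in F1; apply is_derive_unique in F2.
split.
- change (is_derive (fun s => p s / (p s ^ 2 + q s ^ 2)) t
   (- fst df * ((p t * p t - q t * q t) /
      ((p t * p t - q t * q t) ^ 2 + (p t * q t + q t * p t) ^ 2)) -
    - snd df * (- (p t * q t + q t * p t) /
      ((p t * p t - q t * q t) ^ 2 + (p t * q t + q t * p t) ^ 2)))).
  clearbody p q; auto_derive; [repeat split; auto | ].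
  change (fun x : R => p x) with p; change (fun x : R => q x) with q.
  rewrite F1, F2; field; split; intros E; [apply Hq2 | apply Hq]; rewrite <- E; ring.
- change (is_derive (fun s => - q s / (p s ^ 2 + q s ^ 2)) t
   (- fst df * (- (p t * q t + q t * p t) /
      ((p t * p t - q t * q t) ^ 2 + (p t * q t + q t * p t) ^ 2)) +
    - snd df * ((p t * p t - q t * q t) /
      ((p t * p t - q t * q t) ^ 2 + (p t * q t + q t * p t) ^ 2)))).
  clearbody p q; auto_derive; [repeat split; auto | ].
  change (fun x : R => p x) with p; change (fun x : R => q x) with q.
  rewrite F1, F2; field; split; intros E; [apply Hq2 | apply Hq]; rewrite <- E; ring.
Qed.

Lemma is_derive_C_exp (f : R -> C) (t : R) (df : C) :
  is_derive_C f t df -> is_derive_C (fun s => Cexp (f s)) t (df * Cexp (f t))%C.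
Proof.
intros [F1 F2].
unfold is_derive_C, Cexp, Re, Im, Cmult; simpl fst in *; simpl snd in *.
set (p := fun s => fst (f s)) in *; set (q := fun s => snd (f s)) in *.
change (is_derive p t (fst df)) in F1; change (is_derive q t (snd df)) in F2.
change (fst (f t)) with (p t) in *; change (snd (f t)) with (q t) in *.
assert (E1 : ex_derive p t) by (eexists; exact F1).
assert (E2 : ex_derive q t) by (eexists; exact F2).
apply is_derive_unique in F1; apply is_derive_unique in F2.
split.
- change (is_derive (fun s => exp (p s) * cos (q s)) t
    (fst df * (exp (p t) * cos (q t)) - snd df * (exp (p t) * sin (q t)))).
  clearbody p q; auto_derive; [tauto | ].
  change (fun x : R => p x) with p; change (fun x : R => q x) with q.
  rewrite F1, F2; ring.
- change (is_derive (fun s => exp (p s) * sin (q s)) t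
    (fst df * (exp (p t) * sin (q t)) + snd df * (exp (p t) * cos (q t)))).
  clearbody p q; auto_derive; [tauto | ].
  change (fun x : R => p x) with p; change (fun x : R => q x) with q.
  rewrite F1, F2; ring.
Qed.

(** The mean value theorem fails for complex values, so it is applied to the real and imaginary
    parts separately; recombining them costs [sqrt 2], rounded up to 2. *)
Lemma C_increment_bound (f df : R -> C) (M : R) :
  (forall s, 0 <= s <= 1 -> is_derive_C f s (df s)) ->
  (forall s, 0 <= s <= 1 -> Cmod (df s) <= M) ->
  Cmod (f 1 - f 0)%C <= 2 * M.
Proof.
intros Hd Hb.
assert (A : forall p : C -> R, (forall z, Rabs (p z) <= Cmod z) ->
   (forall s, 0 <= s <= 1 -> is_derive (fun s => p (f s)) s (p (df s))) ->
   Rabs (p (f 1) - p (f 0)) <= M).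
{ intros p Hp Hdp.
  destruct (MVT_gen (fun s => p (f s)) 0 1 (fun s => p (df s))) as [c [Hc ->]].
  - intros x Hx; rewrite Rmin_left, Rmax_right in Hx by lra; apply Hdp; lra.
  - intros x Hx; rewrite Rmin_left, Rmax_right in Hx by lra.
    apply continuity_pt_filterlim, (ex_derive_continuous (V := R_NormedModule)).
    eexists; apply Hdp; lra.
  - rewrite Rmin_left, Rmax_right in Hc by lra.
    rewrite Rminus_0_r, Rmult_1_r; eapply Rle_trans; [apply Hp | now apply Hb]. }
assert (A1 := A fst re_le_Cmod (fun s Hs => proj1 (Hd s Hs))).
assert (Him : forall z : C, Rabs (snd z) <= Cmod z).
{ intros z; eapply Rle_trans; [apply Rmax_r | apply Rmax_Cmod]. }
assert (A2 := A snd Him (fun s Hs => proj2 (Hd s Hs))).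
eapply Rle_trans; [apply Cmod_2Rmax | ].
assert (M0 : 0 <= M) by (eapply Rle_trans; [apply Cmod_ge_0 | apply (Hb 0); lra]).
assert (S2 : sqrt 2 <= 2) by (rewrite <- (sqrt_square 2) at 2 by lra; apply sqrt_le_1; lra).
apply Rmult_le_compat; auto using sqrt_pos.
- eapply Rle_trans; [apply Rabs_pos | apply Rmax_l].
- apply Rmax_lub; simpl; assumption.
Qed.

(** * Modulus, kernel and Taylor bounds of the complex exponential *)

Lemma Cmod_Cexp (w : C) : Cmod (Cexp w) = exp (Re w).
Proof.
unfold Cmod, Cexp; simpl.
replace (_ + _) with (exp (Re w) * exp (Re w) * (Rsqr (sin (Im w)) + Rsqr (cos (Im w))))
  by (unfold Rsqr; ring).
rewrite sin2_cos2, Rmult_1_r; apply sqrt_square, Rlt_le, exp_pos.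
Qed.

Lemma Cexp_plus (z w : C) : Cexp (z + w)%C = (Cexp z * Cexp w)%C.
Proof.
unfold Cexp; destruct z as [a b], w as [c d]; unfold Cplus, Cmult; simpl.
rewrite exp_plus, cos_plus, sin_plus; f_equal; ring.
Qed.

Lemma Cexp_0 : Cexp (RtoC 0) = RtoC 1.
Proof. unfold Cexp; simpl; rewrite exp_0, cos_0, sin_0; unfold RtoC; f_equal; ring. Qed.

(** The modulus forces a zero real part, and then [sin] leaves only 0 in this strip. So 0 is the
    only pole of [1 / (Cexp w - 1)] there. *)
Lemma Cexp_eq_1 (w : C) : -PI < Im w < PI -> Cexp w = 1%C -> w = 0%C.
Proof.
intros Hi E; assert (E1 := f_equal Cmod E); rewrite Cmod_Cexp, Cmod_1 in E1.
assert (Hr : Re w = 0) by (apply exp_inv; now rewrite exp_0).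
destruct w as [p q]; unfold Cexp, Re, Im in *; simpl in *; subst p.
rewrite exp_0 in E; injection E as Ec Es.
assert (q = 0); [ | now subst].
destruct (Rtotal_order q 0) as [Hq | [Hq | Hq]]; [ | exact Hq | ].
- assert (0 < sin (- q)) by (apply sin_gt_0; lra); rewrite sin_neg in *; lra.
- assert (0 < sin q) by (apply sin_gt_0; lra); lra.
Qed.

Lemma is_derive_C_exp_scal (w : C) (t : R) :
  is_derive_C (fun s => Cexp (RtoC s * w)%C) t (w * Cexp (RtoC t * w))%C.
Proof.
eapply is_derive_C_eq.
- apply is_derive_C_exp, is_derive_C_mult;
    [apply is_derive_C_RtoC, (is_derive_id (K := R_AbsRing)) | apply is_derive_C_const].
- unfold one; simpl; ring.
Qed.

(** Along [s => Cexp (s w)] the derivative has modulus at most [3 * Cmod w], since [exp 1 <= 3]; the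
    increment bound doubles 3 to 6. In the next two lemmas the preceding bound controls the
    derivative of the new remainder, and its constant doubles each time. *)
Lemma Cexp_taylor0 (w : C) : Cmod w <= 1 -> Cmod (Cexp w - 1)%C <= 6 * Cmod w.
Proof.
intros Hw.
assert (B := C_increment_bound (fun s => Cexp (RtoC s * w)%C)
  (fun s => (w * Cexp (RtoC s * w))%C) (Cmod w * 3)).
cbv beta in B; rewrite Cmult_1_l, Cmult_0_l, Cexp_0 in B.
eapply Rle_trans; [apply B | lra].
- intros s _; apply is_derive_C_exp_scal.
- intros s Hs; rewrite Cmod_mult, Cmod_Cexp; apply Rmult_le_compat_l; [apply Cmod_ge_0 | ].
  eapply Rle_trans; [ | exact exp_le_3].
  assert (R := re_le_Cmod w); apply Rabs_le_between in R.
  assert (E : Re (RtoC s * w)%C = s * Re w) by (destruct w; unfold Re; simpl; ring).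
  rewrite E; destruct (Rle_lt_or_eq_dec (s * Re w) 1) as [H1 | H1]; [nra | | ].
  + now apply Rlt_le, exp_increasing.
  + rewrite H1; lra.
Qed.

Lemma Cmod_RtoC_mult_le (s : R) (w : C) : 0 <= s <= 1 -> Cmod (RtoC s * w)%C <= Cmod w.
Proof.
intros Hs; rewrite Cmod_mult, Cmod_R, Rabs_pos_eq by lra.
assert (H := Cmod_ge_0 w); nra.
Qed.

Lemma Cexp_taylor1 (w : C) : Cmod w <= 1 -> Cmod (Cexp w - 1 - w)%C <= 12 * Cmod w ^ 2.
Proof.
intros Hw.
assert (B := C_increment_bound (fun s => (Cexp (RtoC s * w) + RtoC s * (- w))%C)
  (fun s => (w * (Cexp (RtoC s * w) - 1))%C) (6 * Cmod w ^ 2)).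
cbv beta in B; rewrite !Cmult_1_l, !Cmult_0_l, Cexp_0 in B.
replace (Cexp w - 1 - w)%C with (Cexp w + - w - (1 + 0))%C by ring.
eapply Rle_trans; [apply B | lra].
- intros s _; eapply is_derive_C_eq.
  + apply is_derive_C_plus; [apply is_derive_C_exp_scal | apply is_derive_C_mult;
      [apply is_derive_C_RtoC, (is_derive_id (K := R_AbsRing)) | apply is_derive_C_const]].
  + unfold one; simpl; ring.
- intros s Hs; rewrite Cmod_mult.
  assert (L := Cmod_RtoC_mult_le s w Hs).
  assert (T := Cexp_taylor0 (RtoC s * w)%C ltac:(lra)).
  assert (P := Cmod_ge_0 w); nra.
Qed.

Lemma Cexp_taylor2 (w : C) :
  Cmod w <= 1 -> Cmod (Cexp w - 1 - w - w * w / 2)%C <= 24 * Cmod w ^ 3.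
Proof.
intros Hw.
assert (B := C_increment_bound
  (fun s => (Cexp (RtoC s * w) + RtoC s * (- w) + RtoC (s * s) * (- (w * w / 2)))%C)
  (fun s => (w * (Cexp (RtoC s * w) - 1 - RtoC s * w))%C) (12 * Cmod w ^ 3)).
cbv beta in B; rewrite !Rmult_1_r, !Rmult_0_r, !Cmult_1_l, !Cmult_0_l, Cexp_0 in B.
replace (Cexp w - 1 - w - w * w / 2)%C
  with (Cexp w + - w + - (w * w / 2) - (1 + 0 + 0))%C by ring.
eapply Rle_trans; [apply B | lra].
- intros s _; eapply is_derive_C_eq.
  + apply is_derive_C_plus; [apply is_derive_C_plus | ].
    * apply is_derive_C_exp_scal.
    * apply is_derive_C_mult;
      [apply is_derive_C_RtoC, (is_derive_id (K := R_AbsRing)) | apply is_derive_C_const].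
    * apply is_derive_C_mult; [apply is_derive_C_RtoC | apply is_derive_C_const].
      instantiate (1 := 2 * s); auto_derive; [trivial | ring].
  + unfold one; simpl; rewrite RtoC_mult; field.
- intros s Hs; rewrite Cmod_mult.
  assert (L := Cmod_RtoC_mult_le s w Hs).
  assert (T := Cexp_taylor1 (RtoC s * w)%C ltac:(lra)).
  assert (P := Cmod_ge_0 w); assert (P' := Cmod_ge_0 (RtoC s * w)%C).
  replace (12 * Cmod w ^ 3) with (Cmod w * (12 * Cmod w ^ 2)) by ring.
  apply Rmult_le_compat_l; [exact P | ].
  eapply Rle_trans; [exact T | ]; nra.
Qed.

(** * Continuity, logarithm and the regularized kernel *)

(** The domain is an arbitrary uniform space because the same rules serve functions of the angle, of
    the pair (radius, angle), and of the pair [(theta, a)]. *)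
Lemma continuous_C_pair {U : UniformSpace} (f : U -> C) (x : U) :
  continuous (fun y => fst (f y)) x -> continuous (fun y => snd (f y)) x ->
  continuous f x.
Proof.
intros F1 F2.
apply (continuous_ext (fun y => (fst (f y), snd (f y)))).
- intros y; now destruct (f y).
- apply (continuous_comp_2 (fun y => fst (f y)) (fun y => snd (f y)) (fun a b => (a, b)));
    [exact F1 | exact F2 | ].
  apply (continuous_ext (fun z => z)); [now intros [a b] | apply continuous_id].
Qed.

Lemma continuous_C_fst {U : UniformSpace} (f : U -> C) (x : U) :
  continuous f x -> continuous (fun y => fst (f y)) x.
Proof. intros F; apply (continuous_comp f fst); [exact F | destruct (f x); apply continuous_fst]. Qed.

Lemma continuous_C_snd {U : UniformSpace} (f : U -> C) (x : U) :
  continuous f x -> continuous (fun y => snd (f y)) x.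
Proof. intros F; apply (continuous_comp f snd); [exact F | destruct (f x); apply continuous_snd]. Qed.

Lemma continuous_R_mult {U : UniformSpace} (f g : U -> R) (x : U) :
  continuous f x -> continuous g x -> continuous (fun y => f y * g y) x.
Proof. apply (continuous_mult (K := R_AbsRing)). Qed.

Lemma continuous_R_plus {U : UniformSpace} (f g : U -> R) (x : U) :
  continuous f x -> continuous g x -> continuous (fun y => f y + g y) x.
Proof. apply (continuous_plus (V := R_NormedModule)). Qed.

Lemma continuous_R_opp {U : UniformSpace} (f : U -> R) (x : U) :
  continuous f x -> continuous (fun y => - f y) x.
Proof. apply (continuous_opp (V := R_NormedModule)). Qed.

Lemma continuous_R_comp {U : UniformSpace} (h : R -> R) (f : U -> R) (x : U) :
  continuous f x -> continuity_pt h (f x) -> continuous (fun y => h (f y)) x.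
Proof.
intros F C; apply (continuous_comp f h); [exact F | ].
now apply continuity_pt_filterlim in C.
Qed.

Lemma continuous_C_RtoC {U : UniformSpace} (f : U -> R) (x : U) :
  continuous f x -> continuous (fun y => RtoC (f y)) x.
Proof. intros F; apply continuous_C_pair; simpl; [exact F | apply continuous_const]. Qed.

Lemma continuous_C_plus {U : UniformSpace} (f g : U -> C) (x : U) :
  continuous f x -> continuous g x -> continuous (fun y => (f y + g y)%C) x.
Proof.
intros F G; apply continuous_C_pair; simpl; apply continuous_R_plus;
  auto using @continuous_C_fst, @continuous_C_snd.
Qed.

Lemma continuous_C_opp {U : UniformSpace} (f : U -> C) (x : U) :
  continuous f x -> continuous (fun y => (- f y)%C) x.
Proof.
intros F; apply continuous_C_pair; simpl; apply continuous_R_opp;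
  auto using @continuous_C_fst, @continuous_C_snd.
Qed.

Lemma continuous_C_mult {U : UniformSpace} (f g : U -> C) (x : U) :
  continuous f x -> continuous g x -> continuous (fun y => (f y * g y)%C) x.
Proof.
intros F G; apply continuous_C_pair; simpl; apply continuous_R_plus;
  try apply continuous_R_opp; apply continuous_R_mult;
  auto using @continuous_C_fst, @continuous_C_snd.
Qed.

Lemma continuous_C_norm2 {U : UniformSpace} (f : U -> C) (x : U) :
  continuous f x -> continuous (fun y => fst (f y) ^ 2 + snd (f y) ^ 2) x.
Proof.
intros F; apply continuous_R_plus; simpl; repeat apply continuous_R_mult;
  auto using @continuous_C_fst, @continuous_C_snd, @continuous_const.
Qed.

Lemma continuous_C_inv {U : UniformSpace} (f : U -> C) (x : U) :
  continuous f x -> f x <> 0%C -> continuous (fun y => (/ f y)%C) x.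
Proof.
intros F Hn; assert (Hq := Cnorm2_neq_0 _ Hn).
assert (I : continuous (fun y => / (fst (f y) ^ 2 + snd (f y) ^ 2)) x).
{ apply (continuous_R_comp Rinv); [now apply continuous_C_norm2 | ].
  apply continuity_pt_inv; [apply continuity_pt_id | exact Hq]. }
unfold Cinv; apply continuous_C_pair; simpl fst; simpl snd; apply continuous_R_mult;
  try apply continuous_R_opp; auto using @continuous_C_fst, @continuous_C_snd.
Qed.

Lemma continuous_C_exp {U : UniformSpace} (f : U -> C) (x : U) :
  continuous f x -> continuous (fun y => Cexp (f y)) x.
Proof.
intros F; assert (F1 := continuous_C_fst _ _ F); assert (F2 := continuous_C_snd _ _ F).
unfold Cexp, Re, Im; apply continuous_C_pair; simpl; apply continuous_R_mult;
  [ apply (continuous_R_comp exp) | apply (continuous_R_comp cos)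
  | apply (continuous_R_comp exp) | apply (continuous_R_comp sin)]; auto.
- apply derivable_continuous, derivable_exp.
- apply continuity_cos.
- apply derivable_continuous, derivable_exp.
- apply continuity_sin.
Qed.

Lemma continuous_C_Cmod {U : UniformSpace} (f : U -> C) (x : U) :
  continuous f x -> continuous (fun y => Cmod (f y)) x.
Proof.
intros F; apply (continuous_R_comp sqrt); [now apply continuous_C_norm2 | ].
apply continuity_pt_sqrt; nra.
Qed.

(** Balls of [C] are products of real balls, and the modulus dominates both coordinates. *)
Lemma continuous_C_eps {U : UniformSpace} (f : U -> C) (x : U) :
  (forall eps, 0 < eps -> locally x (fun y => Cmod (f y - f x)%C < eps)) ->
  continuous f x.
Proof.
intros A; apply filterlim_locally; intros eps.
eapply filter_imp; [ | exact (A eps (cond_pos eps))].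
intros y Hy; assert (M := Rmax_Cmod (f y - f x)%C).
split; apply (Rle_lt_trans _ (Cmod (f y - f x)%C)); try exact Hy;
  (eapply Rle_trans; [ | exact M]); [apply Rmax_l | apply Rmax_r].
Qed.

Lemma locally_Rlt {U : UniformSpace} (f : U -> R) (x : U) (b : R) :
  continuous f x -> f x < b -> locally x (fun y => f y < b).
Proof.
intros F Hb; exact (F (fun v => v < b) (open_lt b (f x) Hb)).
Qed.

Lemma locally_Rgt {U : UniformSpace} (f : U -> R) (x : U) (b : R) :
  continuous f x -> b < f x -> locally x (fun y => b < f y).
Proof.
intros F Hb; exact (F (fun v => b < v) (open_gt b (f x) Hb)).
Qed.

Lemma locally_C_eps {U : UniformSpace} (f : U -> C) (x : U) (eps : R) :
  continuous f x -> 0 < eps -> locally x (fun y => Cmod (f y - f x)%C < eps).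
Proof.
intros F He; apply (locally_Rlt (fun y => Cmod (f y - f x)%C)).
- apply continuous_C_Cmod, continuous_C_plus; [exact F | apply continuous_const].
- unfold Cminus; rewrite Cplus_opp_r, Cmod_0; exact He.
Qed.

Lemma locally_C_neq {U : UniformSpace} (f : U -> C) (x : U) (c : C) :
  continuous f x -> f x <> c -> locally x (fun y => f y <> c).
Proof.
intros F Hn.
assert (P : 0 < Cmod (f x - c)%C).
{ apply Cmod_gt_0; intros E; apply Hn.
  replace (f x) with (f x - c + c)%C by ring; rewrite E; ring. }
eapply filter_imp; [ | exact (locally_C_eps f x _ F P)].
intros y Hy E; cbv beta in Hy; rewrite E in Hy.
replace (c - f x)%C with (- (f x - c))%C in Hy by ring.
rewrite Cmod_opp in Hy; lra.
Qed.

(** * The principal logarithm on the right half-plane *)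

(** [atan] of the slope is the argument only when the real part is positive, hence the hypothesis of
    [Cexp_Clog]. *)
Definition Clog (u : C) : C := (ln (Cmod u), atan (snd u / fst u)).

Lemma Cexp_Clog (u : C) : 0 < fst u -> Cexp (Clog u) = u.
Proof.
intros Hu; assert (M0 : 0 < Cmod u).
{ apply Cmod_gt_0; intros ->; simpl in Hu; lra. }
unfold Cexp, Clog; simpl; rewrite exp_ln by exact M0.
rewrite cos_atan, sin_atan.
assert (S : sqrt (1 + (snd u / fst u)²) = Cmod u / fst u).
{ replace (1 + (snd u / fst u)²) with ((fst u ^ 2 + snd u ^ 2) / (fst u * fst u))
    by (unfold Rsqr; field; lra).
  rewrite sqrt_div_alt, sqrt_square by nra; reflexivity. }
rewrite S; destruct u as [p q]; simpl in *; f_equal; field; lra.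
Qed.

Lemma Im_Clog_bound (u : C) : - (PI / 2) < snd (Clog u) < PI / 2.
Proof. simpl; destruct (atan_bound (snd u / fst u)); lra. Qed.

Lemma continuous_Clog {U : UniformSpace} (f : U -> C) (x : U) :
  continuous f x -> 0 < fst (f x) -> continuous (fun y => Clog (f y)) x.
Proof.
intros F Hp; unfold Clog; apply continuous_C_pair; simpl.
- apply (continuous_R_comp ln); [now apply continuous_C_Cmod | ].
  apply continuity_pt_filterlim, continuous_ln, Cmod_gt_0; intros E; rewrite E in Hp; simpl in Hp; lra.
- apply (continuous_R_comp atan).
  + apply continuous_R_mult; [now apply continuous_C_snd | ].
    apply (continuous_R_comp Rinv); [now apply continuous_C_fst | ].
    apply continuity_pt_inv; [apply continuity_pt_id | lra].
  + apply continuity_pt_filterlim, continuous_atan.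
Qed.

Lemma is_derive_C_log (f : R -> C) (t : R) (df : C) :
  is_derive_C f t df -> 0 < fst (f t) ->
  is_derive_C (fun s => Clog (f s)) t (df / f t)%C.
Proof.
intros [F1 F2] Hp.
unfold is_derive_C, Clog, Cmod, Cdiv, Cmult, Cinv; simpl fst in *; simpl snd in *.
set (p := fun s => fst (f s)) in *; set (q := fun s => snd (f s)) in *.
change (is_derive p t (fst df)) in F1; change (is_derive q t (snd df)) in F2.
change (fst (f t)) with (p t) in *; change (snd (f t)) with (q t) in *.
assert (E1 : ex_derive p t) by (eexists; exact F1).
assert (E2 : ex_derive q t) by (eexists; exact F2).
apply is_derive_unique in F1; apply is_derive_unique in F2.
assert (Q : 0 < p t ^ 2 + q t ^ 2) by nra.
assert (SQ := sqrt_lt_R0 _ Q); assert (SS := sqrt_sqrt _ (Rlt_le _ _ Q)).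
split.
- change (is_derive (fun s => ln (sqrt (p s ^ 2 + q s ^ 2))) t
    (fst df * (p t / (p t ^ 2 + q t ^ 2)) - snd df * (- q t / (p t ^ 2 + q t ^ 2)))).
  clearbody p q; auto_derive; [simpl in Q, SQ; repeat split; auto | ].
  change (fun x : R => p x) with p; change (fun x : R => q x) with q.
  rewrite F1, F2.
  replace (p t * (p t * 1) + q t * (q t * 1)) with (p t ^ 2 + q t ^ 2) by ring.
  set (s := sqrt (p t ^ 2 + q t ^ 2)) in *.
  rewrite <- SS; field; lra.
- change (is_derive (fun s => atan (q s / p s)) t
    (fst df * (- q t / (p t ^ 2 + q t ^ 2)) + snd df * (p t / (p t ^ 2 + q t ^ 2)))).
  clearbody p q; auto_derive; [repeat split; auto; lra | ].
  change (fun x : R => p x) with p; change (fun x : R => q x) with q.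
  rewrite F1, F2; unfold Rsqr; field; split; nra.
Qed.

(* The poles of [1/w] and [1/(e^w - 1)] at 0 cancel, leaving the value 1/2. *)
Definition phi (w : C) : C :=
  if Ceq_dec w 0%C then (1 / 2)%C else (/ w - / (Cexp w - 1))%C.

Lemma phi_neq_0 (w : C) : w <> 0%C -> phi w = (/ w - / (Cexp w - 1))%C.
Proof. unfold phi; destruct (Ceq_dec w 0%C); tauto. Qed.

(** With [e = Cexp w - 1 = w + w * w / 2 + r], the difference has a numerator of order [w ^ 3] over
    [2 * (w * e)]. The radius [/ 24] makes [12 * Cmod w ^ 2] at most [Cmod w / 2], so [e] is at
    least half as large as [w]; 100 is a generous constant. *)
Lemma phi_near_0 (w : C) : Cmod w <= / 24 -> Cmod (phi w - 1 / 2)%C <= 100 * Cmod w.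
Proof.
intros Hw; assert (W0 := Cmod_ge_0 w); unfold phi; destruct (Ceq_dec w 0%C) as [E | Hn].
{ unfold Cminus; rewrite Cplus_opp_r, Cmod_0; lra. }
assert (Wp := Cmod_gt_0 w); destruct Wp as [Wp _]; specialize (Wp Hn).
assert (T1 := Cexp_taylor1 w ltac:(lra)); assert (T2 := Cexp_taylor2 w ltac:(lra)).
set (e := (Cexp w - 1)%C) in *; set (r := (e - w - w * w / 2)%C) in *.
assert (Le : Cmod w / 2 <= Cmod e).
{ assert (Tr := Cmod_triangle e (- (e - w))%C).
  replace (e + - (e - w))%C with w in Tr by ring; rewrite Cmod_opp in Tr; nra. }
assert (He : e <> 0%C) by (apply Cmod_gt_0; lra).
assert (H2 : RtoC 2 <> 0%C) by (intros K; injection K; lra).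
replace (/ w - / e - 1 / 2)%C with ((2 * r - w * w * w / 2 - w * r) * / (2 * (w * e)))%C.
2:{ unfold r; field; repeat split; assumption. }
assert (N : Cmod (2 * r - w * w * w / 2 - w * r)%C <= 100 * Cmod w ^ 3).
{ unfold Cminus; eapply Rle_trans; [apply Cmod_triangle | ].
  eapply Rle_trans; [apply Rplus_le_compat_r, Cmod_triangle | ].
  unfold Cdiv; rewrite !Cmod_opp, !Cmod_mult, Cmod_inv, Cmod_R, Rabs_pos_eq by (assumption || lra).
  assert (Cmod w * Cmod r <= / 24 * (24 * Cmod w ^ 3))
    by (apply Rmult_le_compat; auto using Cmod_ge_0).
  assert (0 <= Cmod w ^ 3) by (apply pow_le; lra).
  replace (Cmod w * Cmod w * Cmod w) with (Cmod w ^ 3) by ring; lra. }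
rewrite Cmod_mult, Cmod_inv
  by (apply Cmult_neq_0; [assumption | apply Cmult_neq_0; assumption]).
rewrite !Cmod_mult, Cmod_R, Rabs_pos_eq by lra.
assert (D : Cmod w ^ 2 <= 2 * (Cmod w * Cmod e)) by nra.
assert (D0 : 0 < Cmod w ^ 2) by nra.
apply (Rmult_le_reg_r (2 * (Cmod w * Cmod e))); [lra | ].
rewrite Rmult_assoc, Rinv_l, Rmult_1_r by lra.
eapply Rle_trans; [exact N | ].
replace (100 * Cmod w ^ 3) with (100 * Cmod w * Cmod w ^ 2) by ring.
apply Rmult_le_compat_l; lra.
Qed.

(** Here [phi w - 1] is [/ w] minus [Cexp w / (Cexp w - 1)]. Each term is at most [/ K], the second
    because [Cmod (Cexp w) < exp (- K) < / (1 + K)]. *)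
Lemma phi_near_minus_infty (w : C) (K : R) :
  0 < K -> fst w < - K -> Cmod (phi w - 1)%C <= 2 / K.
Proof.
intros HK Hw.
assert (Ke : 1 + K < exp K) by (apply exp_ineq1; lra).
assert (Wn : w <> 0%C) by (intros ->; simpl in Hw; lra).
assert (M : Cmod (Cexp w) * exp K < 1).
{ rewrite Cmod_Cexp, <- exp_plus, <- exp_0; apply exp_increasing; unfold Re; lra. }
assert (M0 := Cmod_ge_0 (Cexp w)).
assert (D : 1 - Cmod (Cexp w) <= Cmod (Cexp w - 1)%C).
{ assert (Tr := Cmod_triangle (Cexp w) (- (Cexp w - 1))%C).
  replace (Cexp w + - (Cexp w - 1))%C with (RtoC 1) in Tr by ring.
  rewrite Cmod_opp, Cmod_1 in Tr; lra. }
assert (D0 : 0 < Cmod (Cexp w - 1)%C) by nra.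
assert (En : (Cexp w - 1)%C <> 0%C) by now apply Cmod_gt_0.
rewrite phi_neq_0 by exact Wn.
replace (/ w - / (Cexp w - 1) - 1)%C with (/ w + - (Cexp w * / (Cexp w - 1)))%C
  by (field; split; assumption).
eapply Rle_trans; [apply Cmod_triangle | ].
rewrite Cmod_opp, Cmod_mult, !Cmod_inv by assumption.
replace (2 / K) with (/ K + / K) by (field; lra).
apply Rplus_le_compat.
- apply Rinv_le_contravar; [exact HK | ].
  assert (R := re_le_Cmod w); unfold Re in R; rewrite Rabs_left in R by lra; lra.
- apply (Rmult_le_reg_r (Cmod (Cexp w - 1)%C)); [exact D0 | ].
  rewrite Rmult_assoc, Rinv_l, Rmult_1_r by lra.
  apply (Rmult_le_reg_l K); [exact HK | ].
  rewrite <- Rmult_assoc, Rinv_r, Rmult_1_l by lra; nra.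
Qed.

(** The Taylor estimate handles the removable singularity; at any other point of the strip neither
    denominator vanishes. *)
Lemma continuous_phi {U : UniformSpace} (f : U -> C) (x : U) :
  continuous f x -> - PI < Im (f x) < PI -> continuous (fun y => phi (f y)) x.
Proof.
intros F Hi; destruct (Ceq_dec (f x) 0%C) as [E | Hn].
- apply continuous_C_eps; intros eps He.
  (* [/ 24] is the range of [phi_near_0], and [eps / 200] turns its factor 100 into [eps / 2]. *)
  assert (P : 0 < Rmin (/ 24) (eps / 200)) by (apply Rmin_pos; lra).
  eapply filter_imp; [ | exact (locally_C_eps f x _ F P)].
  intros y Hy; rewrite E in Hy |- *.
  replace (f y - 0)%C with (f y) in Hy by ring.
  assert (B : phi 0%C = (1 / 2)%C) by (unfold phi; destruct (Ceq_dec 0%C 0%C); tauto).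
  rewrite B; assert (Y1 := Rmin_l (/ 24) (eps / 200)); assert (Y2 := Rmin_r (/ 24) (eps / 200)).
  eapply Rle_lt_trans; [apply phi_near_0; lra | lra].
- apply (continuous_ext_loc _ (fun y => (/ f y - / (Cexp (f y) - 1))%C)).
  + eapply filter_imp; [ | exact (locally_C_neq f x _ F Hn)].
    intros y Hy; now rewrite phi_neq_0.
  + apply continuous_C_plus; [now apply continuous_C_inv | ].
    apply continuous_C_opp, (continuous_C_inv (fun y => (Cexp (f y) - 1)%C)).
    * apply continuous_C_plus; [now apply continuous_C_exp | apply continuous_const].
    * intros K; apply Hn, Cexp_eq_1; [exact Hi | ].
      replace (Cexp (f x)) with (Cexp (f x) - 1 + 1)%C by ring; rewrite K; ring.
Qed.

(** The derivative of the quotient form of [phi], used only at nonzero points. *)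
Definition dphi (w : C) : C :=
  (- / (w * w) + Cexp w / ((Cexp w - 1) * (Cexp w - 1)))%C.

Lemma Cexp_minus_1_neq_0 (w : C) :
  - PI < Im w < PI -> w <> 0%C -> (Cexp w - 1)%C <> 0%C.
Proof.
intros Hi Hn K; apply Hn, Cexp_eq_1; [exact Hi | ].
replace (Cexp w) with (Cexp w - 1 + 1)%C by ring; rewrite K; ring.
Qed.

Lemma ex_derive_C_continuous (f : R -> C) (t : R) (df : C) :
  is_derive_C f t df -> continuous f t.
Proof.
intros [F1 F2]; apply continuous_C_pair;
  apply (ex_derive_continuous (V := R_NormedModule)); eexists; eassumption.
Qed.

Lemma is_derive_C_phi (f : R -> C) (t : R) (df : C) :
  is_derive_C f t df -> - PI < Im (f t) < PI -> f t <> 0%C ->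
  is_derive_C (fun s => phi (f s)) t (df * dphi (f t))%C.
Proof.
intros F Hi Hn; assert (En := Cexp_minus_1_neq_0 _ Hi Hn).
apply (is_derive_C_ext_loc (fun s => (/ f s + RtoC (-1) * / (Cexp (f s) + - RtoC 1))%C)).
- eapply filter_imp;
    [ | exact (locally_C_neq f t _ (ex_derive_C_continuous _ _ _ F) Hn)].
  intros y Hy; rewrite phi_neq_0 by exact Hy.
  replace (RtoC (-1)) with (- RtoC 1)%C by (unfold RtoC, Copp; simpl; f_equal; ring).
  unfold Cminus; ring.
- eapply is_derive_C_eq.
  + apply is_derive_C_plus; [apply is_derive_C_inv; eassumption | ].
    apply is_derive_C_mult; [apply is_derive_C_const | ].
    apply (is_derive_C_inv (fun s => (Cexp (f s) + - RtoC 1)%C)); [ | exact En].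
    apply is_derive_C_plus; [apply is_derive_C_exp; eassumption | apply is_derive_C_const].
  + replace (RtoC (-1)) with (- RtoC 1)%C by (unfold RtoC, Copp; simpl; f_equal; ring).
    unfold dphi; fold (Cminus (Cexp (f t)) 1); field; split; assumption.
Qed.

Lemma continuous_dphi {U : UniformSpace} (f : U -> C) (x : U) :
  continuous f x -> - PI < Im (f x) < PI -> f x <> 0%C ->
  continuous (fun y => dphi (f y)) x.
Proof.
intros F Hi Hn; assert (En := Cexp_minus_1_neq_0 _ Hi Hn).
assert (E : continuous (fun y => (Cexp (f y) - 1)%C) x)
  by (apply continuous_C_plus; [now apply continuous_C_exp | apply continuous_const]).
unfold dphi; apply continuous_C_plus.
- apply continuous_C_opp, (continuous_C_inv (fun y => (f y * f y)%C));
    [now apply continuous_C_mult | now apply Cmult_neq_0].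
- apply continuous_C_mult; [now apply continuous_C_exp | ].
  apply (continuous_C_inv (fun y => ((Cexp (f y) - 1) * (Cexp (f y) - 1))%C));
    [now apply continuous_C_mult | now apply Cmult_neq_0].
Qed.

(** * Mean value property *)

Lemma eq_of_derive_0 (f : R -> R) (a b : R) :
  a <= b -> (forall s, a <= s <= b -> continuity_pt f s) ->
  (forall s, a < s < b -> is_derive f s 0) -> f b = f a.
Proof.
intros Hab Hc Hd; destruct (MVT_gen f a b (fun _ => 0)) as [c [_ E]].
- intros x Hx; rewrite Rmin_left, Rmax_right in Hx by lra; now apply Hd.
- intros x Hx; rewrite Rmin_left, Rmax_right in Hx by lra; now apply Hc.
- lra.
Qed.

(** The interval is cut at [c], the mean value theorem is applied to each half, and continuity at
    [c] glues the two. This makes it possible to pass the radius of the removable singularity. *)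
Lemma eq_of_derive_0_except (f : R -> R) (a b c : R) :
  a <= b -> (forall s, a <= s <= b -> continuity_pt f s) ->
  (forall s, a < s < b -> s <> c -> is_derive f s 0) -> f b = f a.
Proof.
intros Hab Hc Hd.
destruct (Rlt_dec a c) as [H1 | H1]; [destruct (Rlt_dec c b) as [H2 | H2] | ].
- transitivity (f c); apply eq_of_derive_0; try lra;
    intros s Hs; try (apply Hc; lra); apply Hd; lra.
- apply eq_of_derive_0; [lra | exact Hc | intros s Hs; apply Hd; lra].
- apply eq_of_derive_0; [lra | exact Hc | intros s Hs; apply Hd; lra].
Qed.

Definition clip (s : R) : R := Rmax 0 (Rmin s 1).

Lemma clip_bounds (s : R) : 0 <= clip s <= 1.
Proof.
unfold clip; split; [apply Rmax_l | apply Rmax_lub; [lra | apply Rmin_r]].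
Qed.

Lemma clip_id (s : R) : 0 <= s <= 1 -> clip s = s.
Proof. intros Hs; unfold clip; rewrite Rmin_left, Rmax_right; lra. Qed.

Lemma continuity_pt_clip (s : R) : continuity_pt clip s.
Proof.
intros eps He; exists eps; split; [exact He | ].
intros t [_ Ht]; simpl in *; unfold R_dist in *; eapply Rle_lt_trans; [ | exact Ht].
unfold clip, Rmax, Rmin.
repeat destruct Rle_dec; unfold Rabs; repeat destruct Rcase_abs; lra.
Qed.

Lemma locally_open_interval_neq (a b c s : R) :
  a < s < b -> s <> c -> locally s (fun t => a < t < b /\ t <> c).
Proof.
intros Hs Hn; apply filter_and; [apply filter_and | ].
- now apply (open_gt a s).
- now apply (open_lt b s).
- now apply (open_neq c s).
Qed.

(* [f] is only controlled for a parameter in [0,1]; continuity at the boundary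
   of that range is expressed by clipping the parameter. *)
Lemma RInt_param_eq (f df P : R -> R -> R) (l r c : R) :
  l <= r ->
  (forall q : R * R, continuous (fun q : R * R => f (clip (fst q)) (snd q)) q) ->
  (forall s x, 0 < s < 1 -> s <> c -> is_derive (fun s => f s x) s (df s x)) ->
  (forall s x, 0 < s < 1 -> s <> c ->
     continuous (fun q : R * R => df (fst q) (snd q)) (s, x)) ->
  (forall s x, 0 < s < 1 -> s <> c -> is_derive (P s) x (df s x)) ->
  (forall s, 0 < s < 1 -> P s l = P s r) ->
  RInt (f 1) l r = RInt (f 0) l r.
Proof.
intros Hlr Hc Hd Hdc HP HPe.
set (N := fun s => RInt (fun x => f (clip s) x) l r).
assert (Hx : forall s x, continuous (fun x => f (clip s) x) x).
{ intros s x; apply (continuous_comp_2 (fun _ => s) (fun x => x)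
    (fun a b => f (clip a) b)); [apply continuous_const | apply continuous_id | apply Hc]. }
assert (Hi : forall s, ex_RInt (fun x => f (clip s) x) l r).
{ intros s; apply (ex_RInt_continuous (V := R_CompleteNormedModule)).
  intros x _; apply Hx. }
assert (N1 : N 1 = RInt (f 1) l r) by (unfold N; now rewrite clip_id by lra).
assert (N0 : N 0 = RInt (f 0) l r) by (unfold N; now rewrite clip_id by lra).
rewrite <- N1, <- N0; apply (eq_of_derive_0_except N 0 1 c); [lra | | ].
- intros s _; apply continuity_pt_filterlim, filterlim_locally; intros eps.
  (* Uniform continuity makes the integrands differ by less than this quotient; the [+ 1] keeps it
     meaningful and the final bound strict even when [l = r]. *)
  assert (E2 : 0 < eps / (2 * (r - l + 1))).
  { apply Rdiv_lt_0_compat; [apply cond_pos | lra]. }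
  destruct (uniform_continuity_2d_1d (fun x s => f (clip s) x) l r s) with
    (eps := mkposreal _ E2) as [delta Hdelta].
  { intros x _; apply continuity_2d_pt_filterlim.
    apply (continuous_comp_2 (fun q : R * R => snd q) (fun q => fst q)
      (fun a b => f (clip a) b)); [apply continuous_snd | apply continuous_fst | apply Hc]. }
  exists delta; intros y Hy.
  assert (B : norm (minus (N y) (N s)) <= (r - l) * (eps / (2 * (r - l + 1)))).
  { apply (norm_RInt_le_const (fun x => minus (f (clip y) x) (f (clip s) x)) l r).
    - exact Hlr.
    - intros x Hxx; apply Rlt_le; simpl in Hdelta.
      change (Rabs (f (clip y) x - f (clip s) x) < eps / (2 * (r - l + 1))).
      assert (D := cond_pos delta).
      change (Rabs (y - s) < delta) in Hy; apply Rabs_lt_between in Hy.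
      apply Hdelta; try lra; rewrite Rminus_eq_0, Rabs_R0; exact D.
    - apply (is_RInt_minus (V := R_NormedModule)); apply (RInt_correct (V := R_CompleteNormedModule)), Hi. }
  change (Rabs (N y - N s) < eps); eapply Rle_lt_trans; [exact B | ].
  assert (D := cond_pos eps); set (e := pos eps) in *.
  apply (Rmult_lt_reg_r (2 * (r - l + 1))); [lra | ].
  replace ((r - l) * (e / (2 * (r - l + 1))) * (2 * (r - l + 1))) with ((r - l) * e)
    by (field; lra).
  nra.
- intros s Hs Hn; assert (L := locally_open_interval_neq 0 1 c s Hs Hn).
  apply (is_derive_ext_loc (fun s => RInt (fun x => f s x) l r)).
  { eapply filter_imp; [ | exact L]; intros t [Ht _]; unfold N; now rewrite clip_id by lra. }
  (* The parameter derivative [df s] is also the [x]-derivative of [P s], so its integral telescopes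
     to a difference of equal end values. *)
  assert (Z : RInt (fun x => Derive (fun s => f s x) s) l r = 0).
  { rewrite (RInt_ext _ (df s)) by (intros x _; now apply is_derive_unique, Hd).
    apply is_RInt_unique; replace 0 with (minus (P s r) (P s l))
      by (rewrite (HPe s Hs); unfold minus, plus, opp; simpl; ring).
    apply (is_RInt_derive (V := R_CompleteNormedModule)); [intros x _; now apply HP | ].
    intros x _; apply (continuous_comp_2 (fun _ => s) (fun x => x) df);
      [apply continuous_const | apply continuous_id | now apply Hdc]. }
  rewrite <- Z; apply is_derive_RInt_param.
  + eapply filter_imp; [ | exact L]; intros t [Ht Hn'] x _; eexists; now apply Hd.
  + intros x _; apply continuity_2d_pt_filterlim.
    change (continuous (fun q : R * R => Derive (fun z => f z (snd q)) (fst q)) (s, x)).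
    apply (continuous_ext_loc _ (fun q : R * R => df (fst q) (snd q))).
    * assert (L2 : locally (s, x) (fun q : R * R => 0 < fst q < 1 /\ fst q <> c))
        by exact (continuous_fst s x _ L).
      eapply filter_imp; [ | exact L2]; intros q [Hq Hq']; symmetry.
      now apply is_derive_unique, Hd.
    * now apply Hdc.
  + eapply filter_imp; [ | exact L]; intros t [Ht _].
    generalize (Hi t); now rewrite clip_id by lra.
Qed.

Definition expi (t : R) : C := Cexp (0, t).

Lemma expi_cos_sin (t : R) : expi t = (cos t, sin t).
Proof. unfold expi, Cexp; simpl; rewrite exp_0; f_equal; ring. Qed.

Lemma Cmod_expi (t : R) : Cmod (expi t) = 1.
Proof. unfold expi; rewrite Cmod_Cexp; exact exp_0. Qed.

Lemma expi_opp_mult (t : R) : (expi t * expi (- t))%C = 1%C.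
Proof.
unfold expi; rewrite <- Cexp_plus, <- Cexp_0; f_equal; unfold Cplus, RtoC; simpl; f_equal; ring.
Qed.

Lemma is_derive_C_expi (m t : R) :
  is_derive_C (fun s => expi (m * s)) t ((0, m) * expi (m * t))%C.
Proof.
apply (is_derive_C_exp (fun s => (0, m * s))); split; simpl.
- apply (is_derive_const (V := R_NormedModule)).
- auto_derive; [trivial | ring].
Qed.

Lemma continuous_expi {U : UniformSpace} (f : U -> R) (x : U) :
  continuous f x -> continuous (fun y => expi (f y)) x.
Proof.
intros F; apply continuous_C_exp, continuous_C_pair; [apply continuous_const | exact F].
Qed.

(* [F] has complex derivative [dF]
   inside the disc, expressed through the chain rule along real curves, except
   possibly on the circle of radius [r0], where continuity suffices. *)
Lemma circle_mean_value (F dF : C -> C) (m r0 : R) :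
  m = 2 \/ m = -2 ->
  (forall (f : R * R -> C) q, continuous f q -> (forall y, Cmod (f y) <= 1) ->
     continuous (fun y => F (f y)) q) ->
  (forall f t d, is_derive_C f t d -> Cmod (f t) < 1 -> Cmod (f t) <> r0 ->
     is_derive_C (fun s => F (f s)) t (d * dF (f t))%C) ->
  (forall (f : R * R -> C) q, continuous f q -> Cmod (f q) < 1 -> Cmod (f q) <> r0 ->
     continuous (fun y => dF (f y)) q) ->
  is_RInt (V := C_R_NormedModule) (fun x => F (expi (m * x)))
    (- (PI / 2)) (PI / 2) (RtoC PI * F 0)%C.
Proof.
intros Hm HF HD HdF; assert (P0 := PI_RGT_0).
(* [G s] is [F] on the circle of radius [s], and [dG] is its radial derivative. *)
set (G := fun s x => F (RtoC s * expi (m * x))%C).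
set (dG := fun s x => (expi (m * x) * dF (RtoC s * expi (m * x)))%C).
assert (Mod : forall s x, 0 <= s -> Cmod (RtoC s * expi (m * x))%C = s).
{ intros s x Hs; rewrite Cmod_mult, Cmod_expi, Cmod_R, Rabs_pos_eq; lra. }
assert (CE : forall q : R * R, continuous (fun q : R * R => expi (m * snd q)) q).
{ intros [s x]; apply continuous_expi, continuous_R_mult;
    [apply continuous_const | apply continuous_snd]. }
assert (Gc : forall q : R * R, continuous (fun q : R * R => G (clip (fst q)) (snd q)) q).
{ intros q; apply (HF (fun q => (RtoC (clip (fst q)) * expi (m * snd q))%C)).
  - apply continuous_C_mult; [ | apply CE].
    apply continuous_C_RtoC, (continuous_R_comp clip); [ | apply continuity_pt_clip].
    destruct q; apply continuous_fst.
  - intros y; rewrite Mod; apply clip_bounds. }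
assert (Gd : forall s x, 0 < s < 1 -> s <> r0 -> is_derive_C (fun s => G s x) s (dG s x)).
{ intros s x Hs Hn; eapply is_derive_C_eq.
  - apply HD; [ | rewrite Mod; lra | rewrite Mod; lra].
    apply is_derive_C_mult; [apply is_derive_C_RtoC, (is_derive_id (K := R_AbsRing))
      | apply is_derive_C_const].
  - unfold dG, one; simpl; ring. }
(* The radial and angular derivatives of [s * expi (m * x)] differ by the factor [i m s], so [dG]
   also has an antiderivative in [x]. *)
assert (Gdx : forall s x, 0 < s < 1 -> s <> r0 ->
    is_derive_C (fun x => (/ (Ci * RtoC (m * s)) * G s x)%C) x (dG s x)).
{ intros s x Hs Hn; eapply is_derive_C_eq.
  - apply is_derive_C_mult; [apply is_derive_C_const | ].
    apply HD; [ | rewrite Mod; lra | rewrite Mod; lra].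
    apply is_derive_C_mult; [apply is_derive_C_const | apply is_derive_C_expi].
  - unfold dG.
    replace (Ci * RtoC (m * s))%C with ((0, m) * RtoC s)%C
      by (unfold Ci, Cmult, RtoC; simpl; f_equal; ring).
    field; split; intros K; injection K; lra. }
assert (dGc : forall s x, 0 < s < 1 -> s <> r0 ->
    continuous (fun q : R * R => dG (fst q) (snd q)) (s, x)).
{ intros s x Hs Hn; apply continuous_C_mult; [apply CE | ].
  apply (HdF (fun q : R * R => (RtoC (fst q) * expi (m * snd q))%C)); simpl;
    try (rewrite Mod; lra).
  apply continuous_C_mult; [apply continuous_C_RtoC, continuous_fst | apply CE]. }
(* For [m = 2] or [m = -2] both ends of the interval are sent to the point [- s], so the circle
   closes up. *)
assert (Per : forall s, G s (- (PI / 2)) = G s (PI / 2)).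
{ intros s; unfold G; do 2 f_equal; rewrite !expi_cos_sin.
  destruct Hm as [-> | ->].
  - replace (2 * (PI / 2)) with PI by field; replace (2 * - (PI / 2)) with (- PI) by field.
    rewrite cos_neg, sin_neg, sin_PI; f_equal; ring.
  - replace (-2 * (PI / 2)) with (- PI) by field; replace (-2 * - (PI / 2)) with PI by field.
    rewrite cos_neg, sin_neg, sin_PI; f_equal; ring. }
assert (G0 : forall x, G 0 x = F 0%C) by (intros x; unfold G; now rewrite Cmult_0_l).
assert (I1 : forall x, continuous (fun x => G 1 x) x).
{ intros x; generalize (Gc (1, x)); intros K.
  apply (continuous_ext (fun x => G (clip 1) x)); [intros t; now rewrite clip_id by lra | ].
  apply (continuous_comp_2 (fun _ => 1) (fun x => x) (fun a b => G (clip a) b));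
    [apply continuous_const | apply continuous_id | exact K]. }
(* The mean at radius 1 equals that at radius 0, where [G] is constant; real and imaginary parts are
   treated in turn. *)
assert (E1 : RInt (fun x => fst (G 1 x)) (- (PI / 2)) (PI / 2) = PI * fst (F 0%C)).
{ rewrite (RInt_param_eq (fun s x => fst (G s x)) (fun s x => fst (dG s x))
    (fun s x => fst (/ (Ci * RtoC (m * s)) * G s x)%C) _ _ r0).
  - rewrite (RInt_ext _ (fun _ => fst (F 0%C))) by (intros x _; now rewrite G0).
    rewrite RInt_const; unfold scal; simpl; unfold mult; simpl; field.
  - lra.
  - intros q; apply (continuous_C_fst (fun q : R * R => G (clip (fst q)) (snd q))), Gc.
  - intros s x Hs Hn; apply (Gd s x Hs Hn).
  - intros s x Hs Hn; apply (continuous_C_fst (fun q : R * R => dG (fst q) (snd q)));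
      now apply dGc.
  - intros s x Hs Hn; apply (Gdx s x Hs Hn).
  - intros s _; now rewrite Per. }
assert (E2 : RInt (fun x => snd (G 1 x)) (- (PI / 2)) (PI / 2) = PI * snd (F 0%C)).
{ rewrite (RInt_param_eq (fun s x => snd (G s x)) (fun s x => snd (dG s x))
    (fun s x => snd (/ (Ci * RtoC (m * s)) * G s x)%C) _ _ r0).
  - rewrite (RInt_ext _ (fun _ => snd (F 0%C))) by (intros x _; now rewrite G0).
    rewrite RInt_const; unfold scal; simpl; unfold mult; simpl; field.
  - lra.
  - intros q; apply (continuous_C_snd (fun q : R * R => G (clip (fst q)) (snd q))), Gc.
  - intros s x Hs Hn; apply (Gd s x Hs Hn).
  - intros s x Hs Hn; apply (continuous_C_snd (fun q : R * R => dG (fst q) (snd q)));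
      now apply dGc.
  - intros s x Hs Hn; apply (Gdx s x Hs Hn).
  - intros s _; now rewrite Per. }
apply (is_RInt_ext (V := C_R_NormedModule) (G 1)).
{ intros x _; unfold G; now rewrite Cmult_1_l. }
replace (RtoC PI * F 0)%C with (PI * fst (F 0%C), PI * snd (F 0%C))
  by (destruct (F 0%C); unfold Cmult; simpl; f_equal; ring).
apply (is_RInt_fct_extend_pair (U := R_NormedModule) (V := R_NormedModule)).
- rewrite <- E1; apply (RInt_correct (V := R_CompleteNormedModule)).
  apply (ex_RInt_continuous (V := R_CompleteNormedModule)).
  intros x _; apply (continuous_C_fst (G 1)), I1.
- rewrite <- E2; apply (RInt_correct (V := R_CompleteNormedModule)).
  apply (ex_RInt_continuous (V := R_CompleteNormedModule)).
  intros x _; apply (continuous_C_snd (G 1)), I1.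
Qed.

(** * The two mean values *)

(* The value 1 is the limit of [phi (Clog u + c)] as [u] tends to 0 in the right half-plane. *)
Definition Psi (c u : C) : C :=
  if Rlt_dec 0 (fst u) then phi (Clog u + c)%C else 1%C.

Lemma Psi_pos (c u : C) : 0 < fst u -> Psi c u = phi (Clog u + c)%C.
Proof. unfold Psi; destruct (Rlt_dec 0 (fst u)); tauto. Qed.

(** The logarithm and [c] each stay within [PI / 2], so the sum stays in the strip where
    [Cexp w = 1] only at 0. *)
Lemma Im_Clog_plus (c u : C) :
  - (PI / 2) < snd c < PI / 2 -> - PI < Im (Clog u + c)%C < PI.
Proof.
intros Hc; assert (L := Im_Clog_bound u).
unfold Im; change (snd (Clog u + c)%C) with (snd (Clog u) + snd c); lra.
Qed.

Lemma continuous_Psi_pos {U : UniformSpace} (c : C) (f : U -> C) (x : U) :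
  - (PI / 2) < snd c < PI / 2 ->
  continuous f x -> 0 < fst (f x) -> continuous (fun y => Psi c (f y)) x.
Proof.
intros Hc F Hp.
apply (continuous_ext_loc _ (fun y => phi (Clog (f y) + c)%C)).
- eapply filter_imp; [ | exact (locally_Rgt _ x 0 (continuous_C_fst f x F) Hp)].
  intros y Hy; now rewrite Psi_pos.
- apply (continuous_phi (fun y => (Clog (f y) + c)%C)); [ | now apply Im_Clog_plus].
  apply continuous_C_plus; [now apply continuous_Clog | apply continuous_const].
Qed.

(** Near 0 the logarithm has a very negative real part on the right half-plane, which puts [phi]
    close to 1; elsewhere [Psi] is exactly 1. *)
Lemma continuous_Psi_0 {U : UniformSpace} (c : C) (f : U -> C) (x : U) :
  continuous f x -> f x = 0%C -> continuous (fun y => Psi c (f y)) x.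
Proof.
intros F E; apply continuous_C_eps; intros eps He; rewrite E.
assert (P0 : Psi c 0%C = 1%C) by (unfold Psi; destruct Rlt_dec as [K | K]; [simpl in K; lra | easy]).
(* With this [K] the bound [2 / K] is two thirds of [eps], and a modulus below [exp (- K - fst c)]
   pushes the real part of [Clog (f y) + c] below [- K]. *)
rewrite P0; set (K := 3 / eps).
assert (HK : 0 < K) by (apply Rdiv_lt_0_compat; lra).
eapply filter_imp; [ | exact (locally_C_eps f x _ F (exp_pos (- K - fst c)))].
intros y Hy; cbv beta in Hy; rewrite E in Hy; replace (f y - 0)%C with (f y) in Hy by ring.
unfold Psi; destruct Rlt_dec as [Hp | Hp].
- eapply Rle_lt_trans; [apply (phi_near_minus_infty _ K HK) | ].
  + change (ln (Cmod (f y)) + fst c < - K).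
    apply ln_increasing in Hy; [rewrite ln_exp in Hy; lra | ].
    apply Cmod_gt_0; intros Z; rewrite Z in Hp; simpl in Hp; lra.
  + unfold K; replace (2 / (3 / eps)) with (2 / 3 * eps) by (field; lra); lra.
- unfold Cminus; rewrite Cplus_opp_r, Cmod_0; exact He.
Qed.

(** The translated disc touches the imaginary axis only at the image of [z = -1], the one boundary
    point where the logarithm is singular. *)
Lemma one_plus_closed_disc (z : C) :
  Cmod z <= 1 -> 0 < fst (1 + z)%C \/ (1 + z)%C = 0%C.
Proof.
intros Hz; assert (Q : fst z ^ 2 + snd z ^ 2 <= 1).
{ rewrite <- sqrt_1 in Hz; apply sqrt_le_0 in Hz; nra. }
destruct z as [p q]; simpl in *.
destruct (Rlt_dec 0 (1 + p)) as [Hp | Hp]; [now left | right].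
assert (p = -1) by nra; subst p; assert (q = 0) by nra; subst q.
unfold Cplus, RtoC; simpl; f_equal; ring.
Qed.

Lemma one_plus_open_disc (z : C) : Cmod z < 1 -> 0 < fst (1 + z)%C.
Proof.
intros Hz; assert (R := re_le_Cmod z); apply Rabs_le_between in R.
unfold Re in R; simpl; lra.
Qed.

Lemma continuous_Psi_disc {U : UniformSpace} (c : C) (f : U -> C) (x : U) :
  - (PI / 2) < snd c < PI / 2 ->
  continuous f x -> Cmod (f x) <= 1 -> continuous (fun y => Psi c (1 + f y)%C) x.
Proof.
intros Hc F Hx.
assert (F1 : continuous (fun y => (1 + f y)%C) x)
  by (apply continuous_C_plus; [apply continuous_const | exact F]).
destruct (one_plus_closed_disc _ Hx) as [Hp | H0].
- now apply (continuous_Psi_pos c (fun y => (1 + f y)%C)).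
- now apply (continuous_Psi_0 c (fun y => (1 + f y)%C)).
Qed.

(** A zero would give [1 + z = Cexp (- c)], so all zeros lie on one circle about 0. Its radius is
    the exceptional one in the mean value property. *)
Lemma Clog_plus_neq_0 (c z : C) :
  0 < fst (1 + z)%C -> Cmod z <> Cmod (Cexp (- c) - 1)%C -> (Clog (1 + z) + c)%C <> 0%C.
Proof.
intros Hp Hn E; apply Hn; f_equal.
replace (- c)%C with (Clog (1 + z)%C).
- rewrite Cexp_Clog by exact Hp; ring.
- replace (Clog (1 + z)%C) with (Clog (1 + z) + c - c)%C by ring; rewrite E; ring.
Qed.

Lemma is_RInt_Psi (c : C) :
  - (PI / 2) < snd c < PI / 2 ->
  is_RInt (V := C_R_NormedModule) (fun x => Psi c (1 + expi (2 * x))%C)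
    (- (PI / 2)) (PI / 2) (RtoC PI * phi c)%C.
Proof.
intros Hc.
(* The value at the centre of the disc, since [Clog 1 = 0]. *)
assert (E : phi c = Psi c (1 + 0)%C).
{ rewrite Cplus_0_r, Psi_pos by (simpl; lra); f_equal.
  unfold Clog; rewrite Cmod_1, ln_1; simpl.
  replace (0 / 1) with 0 by field; rewrite atan_0.
  destruct c; unfold Cplus; simpl; f_equal; ring. }
rewrite E.
apply (circle_mean_value (fun z => Psi c (1 + z)%C)
  (fun z => (dphi (Clog (1 + z) + c) / (1 + z))%C) 2 (Cmod (Cexp (- c) - 1)%C)).
- now left.
- intros f q F Hm; now apply continuous_Psi_disc.
- intros f t d F Hm Hn; assert (Hp := one_plus_open_disc _ Hm).
  assert (F1 : is_derive_C (fun s => (1 + f s)%C) t (0 + d)%C)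
    by (apply is_derive_C_plus; [apply is_derive_C_const | exact F]).
  apply (is_derive_C_ext_loc (fun s => phi (Clog (1 + f s) + c)%C)).
  + eapply filter_imp; [ | exact (locally_Rgt _ t 0
      (continuous_C_fst _ t (ex_derive_C_continuous _ _ _ F1)) Hp)].
    intros y Hy; now rewrite Psi_pos.
  + eapply is_derive_C_eq.
    * apply (is_derive_C_phi (fun s => (Clog (1 + f s) + c)%C));
        [ | now apply Im_Clog_plus | now apply Clog_plus_neq_0].
      apply is_derive_C_plus; [ | apply is_derive_C_const].
      apply (is_derive_C_log (fun s => (1 + f s)%C)); eassumption.
    * field; intros K; rewrite K in Hp; simpl in Hp; lra.
- intros f q F Hm Hn; assert (Hp := one_plus_open_disc _ Hm).
  assert (F1 : continuous (fun y => (1 + f y)%C) q)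
    by (apply continuous_C_plus; [apply continuous_const | exact F]).
  apply continuous_C_mult.
  + apply (continuous_dphi (fun y => (Clog (1 + f y) + c)%C));
      [ | now apply Im_Clog_plus | now apply Clog_plus_neq_0].
    apply continuous_C_plus; [ | apply continuous_const].
    now apply (continuous_Clog (fun y => (1 + f y)%C)).
  + apply (continuous_C_inv (fun y => (1 + f y)%C)); [exact F1 | ].
    intros K; rewrite K in Hp; simpl in Hp; lra.
Qed.

Lemma affine_neq_0 (A B z : C) : Cmod A < Cmod B -> Cmod z <= 1 -> (A * z + B)%C <> 0%C.
Proof.
intros HAB Hz E; assert (E' : B = (- (A * z))%C).
{ replace B with (A * z + B - A * z)%C by ring; rewrite E; ring. }
rewrite E', Cmod_opp, Cmod_mult in HAB; assert (P := Cmod_ge_0 A); nra.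
Qed.

(** The pole [- B / A] (if [A] is nonzero) lies outside the closed unit disc, so the mean is the
    value [/ B] at the centre. *)
Lemma is_RInt_inv_affine_out (A B : C) :
  Cmod A < Cmod B ->
  is_RInt (V := C_R_NormedModule) (fun x => / (A * expi (2 * x) + B))%C
    (- (PI / 2)) (PI / 2) (RtoC PI / B)%C.
Proof.
intros HAB.
replace (RtoC PI / B)%C with (RtoC PI * / (A * 0 + B))%C
  by (rewrite Cmult_0_r, Cplus_0_l; reflexivity).
assert (Co : forall (f : R * R -> C) q, continuous f q ->
    continuous (fun y => (A * f y + B)%C) q).
{ intros f q F; apply continuous_C_plus; [ | apply continuous_const].
  apply continuous_C_mult; [apply continuous_const | exact F]. }
(* The radius 2 lies outside the disc, so no circle in it is exceptional. *)
apply (circle_mean_value (fun z => / (A * z + B))%C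
  (fun z => (- A / ((A * z + B) * (A * z + B)))%C) 2 2); [now left | | | ].
- intros f q F Hm; apply (continuous_C_inv (fun y => (A * f y + B)%C));
    [now apply Co | now apply affine_neq_0].
- intros f t d F Hm _; assert (Hn := affine_neq_0 A B (f t) HAB (Rlt_le _ _ Hm)).
  eapply is_derive_C_eq.
  + apply (is_derive_C_inv (fun s => (A * f s + B)%C)); [ | exact Hn].
    apply is_derive_C_plus; [ | apply is_derive_C_const].
    apply is_derive_C_mult; [apply is_derive_C_const | exact F].
  + cbv beta; field; exact Hn.
- intros f q F Hm _; assert (Hn := affine_neq_0 A B (f q) HAB (Rlt_le _ _ Hm)).
  apply continuous_C_mult; [apply continuous_const | ].
  apply (continuous_C_inv (fun y => ((A * f y + B) * (A * f y + B))%C));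
    [apply continuous_C_mult; now apply Co | now apply Cmult_neq_0].
Qed.

Lemma is_RInt_inv_affine_in (A B : C) :
  Cmod B < Cmod A ->
  is_RInt (V := C_R_NormedModule) (fun x => / (A * expi (2 * x) + B))%C
    (- (PI / 2)) (PI / 2) (RtoC 0).
Proof.
intros HAB.
(* With [z = e^(-2ix)] the integrand is [z / (B z + A)], which vanishes at 0. *)
apply (is_RInt_ext (V := C_R_NormedModule)
  (fun x => expi (-2 * x) * / (B * expi (-2 * x) + A))%C).
{ intros x _; assert (E := expi_opp_mult (2 * x)).
  change (@eq C (expi (-2 * x) * / (B * expi (-2 * x) + A))%C (/ (A * expi (2 * x) + B))%C).
  replace (- (2 * x)) with (-2 * x) in E by ring.
  assert (Hm : Cmod (expi (-2 * x)) <= 1) by (rewrite Cmod_expi; lra).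
  assert (Hn := affine_neq_0 B A _ HAB Hm).
  replace (A * expi (2 * x) + B)%C with (expi (2 * x) * (B * expi (-2 * x) + A))%C.
  - assert (Hz : expi (2 * x) <> 0%C) by (apply Cmod_gt_0; rewrite Cmod_expi; lra).
    replace (expi (-2 * x)) with (expi (2 * x) * expi (-2 * x) * / expi (2 * x))%C at 1
      by (field; exact Hz).
    rewrite E; field; split; assumption.
  - replace (expi (2 * x) * (B * expi (-2 * x) + A))%C
      with (A * expi (2 * x) + B * (expi (2 * x) * expi (-2 * x)))%C by ring.
    rewrite E; ring. }
replace (RtoC 0) with (RtoC PI * (0 * / (B * 0 + A)))%C by ring.
assert (Co : forall (f : R * R -> C) q, continuous f q ->
    continuous (fun y => (B * f y + A)%C) q).
{ intros f q F; apply continuous_C_plus; [ | apply continuous_const].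
  apply continuous_C_mult; [apply continuous_const | exact F]. }
apply (circle_mean_value (fun z => z * / (B * z + A))%C
  (fun z => (A / ((B * z + A) * (B * z + A)))%C) (-2) 2); [now right | | | ].
- intros f q F Hm; apply continuous_C_mult; [exact F | ].
  apply (continuous_C_inv (fun y => (B * f y + A)%C));
    [now apply Co | now apply affine_neq_0].
- intros f t d F Hm _; assert (Hn := affine_neq_0 B A (f t) HAB (Rlt_le _ _ Hm)).
  eapply is_derive_C_eq.
  + apply is_derive_C_mult; [exact F | ].
    apply (is_derive_C_inv (fun s => (B * f s + A)%C)); [ | exact Hn].
    apply is_derive_C_plus; [ | apply is_derive_C_const].
    apply is_derive_C_mult; [apply is_derive_C_const | exact F].
  + cbv beta; field; exact Hn.
- intros f q F Hm _; assert (Hn := affine_neq_0 B A (f q) HAB (Rlt_le _ _ Hm)).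
  apply continuous_C_mult; [apply continuous_const | ].
  apply (continuous_C_inv (fun y => ((B * f y + A) * (B * f y + A))%C));
    [apply continuous_C_mult; now apply Co | now apply Cmult_neq_0].
Qed.

(** * Passage to the open interval and decomposition of the integrand *)

(** The integral of [g] is jointly continuous in its two endpoints, and strictly inside the interval
    it agrees with that of [f]. *)
Lemma is_open_integral_of_continuous (f g : R -> C) (l r : R) (I : C) :
  l < r -> (forall x, continuous g x) -> (forall x, l < x < r -> g x = f x) ->
  is_RInt (V := C_R_NormedModule) g l r I -> is_open_integral f l r I.
Proof.
intros Hlr Hg E HI.
assert (Ex : forall a b, is_RInt (V := C_R_NormedModule) g a b
    (RInt (V := C_R_CompleteNormedModule) g a b)).
{ intros a b; apply (RInt_correct (V := C_R_CompleteNormedModule)).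
  apply (ex_RInt_continuous (V := C_R_CompleteNormedModule)); intros x _; apply Hg. }
assert (Cn := continuous_RInt (V := C_R_NormedModule) g l r
  (RInt (V := C_R_CompleteNormedModule) g)
  (filter_forall _ (fun z => Ex (fst z) (snd z)))).
intros P HP.
assert (EI : RInt (V := C_R_CompleteNormedModule) g l r = I)
  by (apply (is_RInt_unique (V := C_R_CompleteNormedModule)); exact HI).
assert (HP' : locally (RInt (V := C_R_CompleteNormedModule) g l r) P) by now rewrite EI.
destruct (Cn P HP') as [eps Heps].
(* The half-length keeps [a] left of the midpoint and [b] right of it, so the endpoints stay
   ordered. *)
set (d := Rmin eps ((r - l) / 2)).
assert (D0 : 0 < d) by (apply Rmin_pos; [apply cond_pos | lra]).
assert (D1 : d <= eps) by apply Rmin_l; assert (D2 : d <= (r - l) / 2) by apply Rmin_r.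
exists (fun a => l < a < l + d) (fun b => r - d < b < r).
- exists (mkposreal d D0); intros y Hy Hl; change (Rabs (y - l) < d) in Hy.
  apply Rabs_lt_between in Hy; lra.
- exists (mkposreal d D0); intros y Hy Hr; change (Rabs (y - r) < d) in Hy.
  apply Rabs_lt_between in Hy; lra.
- intros a b Ha Hb; exists (RInt (V := C_R_CompleteNormedModule) g a b); split.
  + apply (is_RInt_ext (V := C_R_NormedModule) g); [ | apply Ex].
    simpl; intros x Hx; rewrite Rmin_left, Rmax_right in Hx by lra; apply E; lra.
  + apply (Heps (a, b)); split; [change (Rabs (a - l) < eps) | change (Rabs (b - r) < eps)];
      apply Rabs_lt_between; lra.
Qed.

(** The complex number [i theta - a], that is, the [c] of the decomposition. *)
Definition shift (theta a : R) : C := (- a, theta).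

Lemma Ci_RtoC_minus (theta a : R) : (Ci * RtoC theta - RtoC a)%C = shift theta a.
Proof. unfold shift, Ci, RtoC, Cminus, Cplus, Copp, Cmult; simpl; f_equal; ring. Qed.

Lemma one_plus_expi_double (x : R) : (1 + expi (2 * x))%C = (2 * cos x * cos x, 2 * cos x * sin x).
Proof.
rewrite expi_cos_sin, cos_2a_cos, sin_2a; unfold RtoC, Cplus; simpl; f_equal; ring.
Qed.

(** Since [1 + expi (2 * x) = 2 * cos x * expi x], the modulus is [2 * cos x] and the argument is
    [x] on this interval. *)
Lemma Clog_one_plus_expi (x : R) :
  - (PI / 2) < x < PI / 2 -> Clog (1 + expi (2 * x))%C = (ln (2 * cos x), x).
Proof.
intros Hx; assert (Cx : 0 < cos x) by (apply cos_gt_0; lra).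
rewrite one_plus_expi_double; unfold Clog, Cmod; simpl fst; simpl snd; f_equal.
- f_equal; replace (_ + _) with ((2 * cos x) * (2 * cos x) * ((sin x)² + (cos x)²))
    by (unfold Rsqr; ring).
  rewrite sin2_cos2, Rmult_1_r; apply sqrt_square; lra.
- replace (2 * cos x * sin x / (2 * cos x * cos x)) with (tan x)
    by (unfold tan; field; lra).
  apply atan_tan; lra.
Qed.

(** With [w = Clog (1 + z) + c] one has [Cexp w = Cexp c * (1 + z)], so the second summand is
    [/ (Cexp w - 1)] and cancels the one in [phi w], leaving [/ w]. *)
Lemma integrand_eq (theta a x : R) :
  - (PI / 2) < theta < PI / 2 -> a <> ln (2 * cos theta) -> - (PI / 2) < x < PI / 2 ->
  (Psi (shift theta a) (1 + expi (2 * x))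
   + / (Cexp (shift theta a) * expi (2 * x) + (Cexp (shift theta a) - 1)))%C = integrand theta a x.
Proof.
intros Ht Ha Hx; assert (Cx : 0 < cos x) by (apply cos_gt_0; lra).
assert (Hp : 0 < fst (1 + expi (2 * x))%C) by (rewrite one_plus_expi_double; simpl; nra).
set (c := shift theta a).
set (w := (Clog (1 + expi (2 * x)) + c)%C).
assert (Ew : w = (ln (2 * cos x) - a, x + theta)).
{ unfold w; rewrite Clog_one_plus_expi by exact Hx; reflexivity. }
(* A zero of [w] forces [x = - theta], and then [a] takes the excluded value. *)
assert (Wn : w <> 0%C).
{ rewrite Ew; intros K; injection K as K1 K2; apply Ha.
  replace x with (- theta) in K1 by lra; rewrite cos_neg in K1; lra. }
assert (Wi : - PI < Im w < PI) by now apply Im_Clog_plus.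
assert (En := Cexp_minus_1_neq_0 _ Wi Wn).
rewrite Psi_pos by exact Hp; fold w; rewrite phi_neq_0 by exact Wn.
replace (Cexp c * expi (2 * x) + (Cexp c - 1))%C with (Cexp w - 1)%C.
- unfold integrand.
  replace (Ci * RtoC (x + theta) - RtoC a + RtoC (ln (2 * cos x)))%C with w.
  + field; split; assumption.
  + rewrite Ew, Ci_RtoC_minus; unfold shift, RtoC, Cplus; simpl; f_equal; ring.
- unfold w; rewrite Cexp_plus, Cexp_Clog by exact Hp; ring.
Qed.

(** This is [|A - 1|^2 = |A|^2 + 1 - 2 Re A]. Comparing the two moduli thus amounts to comparing
    [exp a] with [2 * cos theta], which is the source of the unit step. *)
Lemma Cmod_Cexp_minus_1_sqr (theta a : R) :
  Cmod (Cexp (shift theta a) - 1)%C ^ 2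
  = Cmod (Cexp (shift theta a)) ^ 2 + (1 - 2 * cos theta * exp (- a)).
Proof.
unfold Cmod; rewrite !pow2_sqrt by nra; unfold Cexp, shift; simpl.
assert (S := sin2_cos2 theta); unfold Rsqr in S; nra.
Qed.

Lemma exp_opp_mult (a : R) : exp a * exp (- a) = 1.
Proof. rewrite <- exp_plus, Rplus_opp_r; apply exp_0. Qed.

Lemma Cexp_in_disc (theta a : R) :
  0 < cos theta -> a < ln (2 * cos theta) ->
  Cmod (Cexp (shift theta a) - 1)%C < Cmod (Cexp (shift theta a)).
Proof.
intros Ct Ha; assert (Q := Cmod_Cexp_minus_1_sqr theta a).
apply exp_increasing in Ha; rewrite exp_ln in Ha by lra.
assert (E := exp_opp_mult a); assert (P := exp_pos (- a)).
apply Rnot_le_lt; intros K; assert (M := Cmod_ge_0 (Cexp (shift theta a))).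
assert (Cmod (Cexp (shift theta a)) ^ 2 <= Cmod (Cexp (shift theta a) - 1)%C ^ 2)
  by (apply pow_incr; lra).
nra.
Qed.

Lemma Cexp_out_disc (theta a : R) :
  0 < cos theta -> ln (2 * cos theta) < a ->
  Cmod (Cexp (shift theta a)) < Cmod (Cexp (shift theta a) - 1)%C.
Proof.
intros Ct Ha; assert (Q := Cmod_Cexp_minus_1_sqr theta a).
apply exp_increasing in Ha; rewrite exp_ln in Ha by lra.
assert (E := exp_opp_mult a); assert (P := exp_pos (- a)).
apply Rnot_le_lt; intros K; assert (M := Cmod_ge_0 (Cexp (shift theta a) - 1)%C).
assert (Cmod (Cexp (shift theta a) - 1)%C ^ 2 <= Cmod (Cexp (shift theta a)) ^ 2)
  by (apply pow_incr; lra).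
nra.
Qed.

(** The integral [J] of the second term is a parameter because it depends on whether the pole is
    inside or outside the circle. *)
Lemma is_open_integral_integrand (theta a : R) (J : C) :
  - (PI / 2) < theta < PI / 2 -> a <> ln (2 * cos theta) ->
  is_RInt (V := C_R_NormedModule)
    (fun x => / (Cexp (shift theta a) * expi (2 * x) + (Cexp (shift theta a) - 1)))%C
    (- (PI / 2)) (PI / 2) J ->
  is_open_integral (integrand theta a) (- (PI / 2)) (PI / 2)
    (RtoC PI * phi (shift theta a) + J)%C.
Proof.
intros Ht Ha HJ; assert (P0 := PI_RGT_0).
assert (Ct : 0 < cos theta) by (apply cos_gt_0; lra).
apply (is_open_integral_of_continuous _ (fun x =>
  (Psi (shift theta a) (1 + expi (2 * x))
   + / (Cexp (shift theta a) * expi (2 * x) + (Cexp (shift theta a) - 1)))%C)).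
- lra.
- intros x.
  assert (Ce : continuous (fun x : R => expi (2 * x)) x)
    by (apply continuous_expi, continuous_R_mult; [apply continuous_const | apply continuous_id]).
  apply continuous_C_plus.
  + apply (continuous_Psi_disc _ (fun x : R => expi (2 * x)));
      [exact Ht | exact Ce | rewrite Cmod_expi; lra].
  + set (A := Cexp (shift theta a)).
    apply (continuous_C_inv (fun x : R => (A * expi (2 * x) + (A - 1))%C)).
    * apply continuous_C_plus; [ | apply continuous_const].
      apply continuous_C_mult; [apply continuous_const | exact Ce].
    (* A zero on the unit circle would give [Cmod A = Cmod (A - 1)], which happens only for the
       excluded [a]. *)
    * intros K; assert (K1 : Cmod (A * expi (2 * x))%C = Cmod (- (A - 1))%C).
      { f_equal; replace (A * expi (2 * x))%C
          with (A * expi (2 * x) + (A - 1) - (A - 1))%C by ring; rewrite K; ring. }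
      rewrite Cmod_opp, Cmod_mult, Cmod_expi, Rmult_1_r in K1.
      destruct (Rtotal_order a (ln (2 * cos theta))) as [L | [L | L]]; [ | tauto | ].
      -- assert (D := Cexp_in_disc _ _ Ct L); fold A in D; lra.
      -- assert (D := Cexp_out_disc _ _ Ct L); fold A in D; lra.
- intros x Hx; now apply integrand_eq.
- apply (is_RInt_plus (V := C_R_NormedModule)); [now apply is_RInt_Psi | exact HJ].
Qed.

(** * Comparison with the closed form *)

Lemma pair_neq_0 (theta a : R) : (theta, a) <> (0, 0) -> shift theta a <> 0%C.
Proof. intros Hn K; injection K as K1 K2; apply Hn; f_equal; lra. Qed.

(** The step factor is 1, and [/ c + / (1 - Cexp c)] is [phi c]. The strip of half-width [PI] is the
    one where [Cexp c = 1] only at 0. *)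
Lemma closed_form_in (theta a : R) :
  - PI < theta < PI -> a < ln (2 * cos theta) -> (theta, a) <> (0, 0) ->
  closed_form theta a = (RtoC PI * phi (shift theta a))%C.
Proof.
intros Ht Ha Hn; apply pair_neq_0 in Hn.
assert (En := Cexp_minus_1_neq_0 (shift theta a) Ht Hn).
unfold closed_form; rewrite Ci_RtoC_minus, phi_neq_0 by exact Hn.
unfold H; destruct Rlt_dec as [K | K]; [ | lra].
field; repeat split; try assumption.
intros Z; apply En; replace (Cexp (shift theta a) - 1)%C with (- (1 - Cexp (shift theta a)))%C by ring.
rewrite Z; ring.
Qed.

Theorem mainTheorem5 (theta a : R)
  (Htheta : - (PI / 2) < theta < PI / 2)
  (Ha : a <> ln (2 * cos theta)) :
  ((theta, a) <> (0, 0) ->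
     is_open_integral (integrand theta a) (- (PI / 2)) (PI / 2)
       (closed_form theta a))
  /\
  (* the removable singularity of the right-hand side *)
  ((theta, a) = (0, 0) ->
     exists I : C,
       is_open_integral (integrand theta a) (- (PI / 2)) (PI / 2) I
       /\ filterlim (fun p : R * R => closed_form (fst p) (snd p))
            (locally' (theta, a)) (locally I)).
Proof.
assert (P0 := PI_RGT_0); assert (Ct : 0 < cos theta) by (apply cos_gt_0; lra).
(* When the pole is inside the circle the second term integrates to 0. This also covers
   [theta = a = 0]. *)
assert (Inside : a < ln (2 * cos theta) -> is_open_integral (integrand theta a)
    (- (PI / 2)) (PI / 2) (RtoC PI * phi (shift theta a))%C).
{ intros L; rewrite <- (Cplus_0_r (RtoC PI * phi _)).
  apply is_open_integral_integrand; [exact Htheta | exact Ha | ].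
  now apply is_RInt_inv_affine_in, Cexp_in_disc. }
split.
- intros Hn; destruct (Rtotal_order a (ln (2 * cos theta))) as [L | [L | L]]; [ | tauto | ].
  + rewrite closed_form_in; [now apply Inside | lra | exact L | exact Hn].
  + assert (Hc := pair_neq_0 _ _ Hn).
    assert (Hi : - PI < Im (shift theta a) < PI) by (simpl; lra).
    assert (En := Cexp_minus_1_neq_0 _ Hi Hc).
    (* Outside, the step vanishes, and adding [PI / (Cexp c - 1)] to [PI * phi c] leaves
       [PI / c]. *)
    replace (closed_form theta a)
      with (RtoC PI * phi (shift theta a) + RtoC PI / (Cexp (shift theta a) - 1))%C.
    * apply is_open_integral_integrand; [exact Htheta | exact Ha | ].
      now apply is_RInt_inv_affine_out, Cexp_out_disc.
    * unfold closed_form; rewrite Ci_RtoC_minus, phi_neq_0 by exact Hc.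
      unfold H; destruct Rlt_dec as [K | K]; [lra | ].
      rewrite Cmult_0_r; field; split; assumption.
(* Since [0 < ln 2], the origin belongs to the inside case, and continuity of [phi] at 0 supplies
   the limit. *)
- intros E; injection E as -> ->; exists (RtoC PI * phi (shift 0 0))%C.
  assert (L2 : 0 < ln (2 * cos 0))
    by (rewrite cos_0, Rmult_1_r, <- ln_1; apply ln_increasing; lra).
  split; [now apply Inside | ].
  assert (Cf : continuous (fun p : R * R => fst p) (0, 0)) by apply continuous_fst.
  assert (Cs : continuous (fun p : R * R => snd p) (0, 0)) by apply continuous_snd.
  assert (Lim : continuous (fun p : R * R => (RtoC PI * phi (shift (fst p) (snd p)))%C) (0, 0)).
  { apply continuous_C_mult; [apply continuous_const | ].
    apply (continuous_phi (fun p : R * R => (shift (fst p) (snd p)))); [ | simpl; lra].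
    apply continuous_C_pair; [now apply continuous_R_opp | exact Cf]. }
  eapply filterlim_ext_loc; [ | eapply filterlim_filter_le_1; [ | exact Lim]].
  + assert (B1 := locally_Rgt (fun p : R * R => fst p) (0, 0) (- PI) Cf ltac:(simpl; lra)).
    assert (B2 := locally_Rlt (fun p : R * R => fst p) (0, 0) PI Cf ltac:(simpl; lra)).
    (* The inside condition is open, so near the origin the closed form is [PI * phi] at every point
       except the origin itself. *)
    assert (B3 : locally ((0, 0) : R * R) (fun p : R * R => 0 < ln (2 * cos (fst p)) + - snd p)).
    { apply (locally_Rgt (fun p : R * R => ln (2 * cos (fst p)) + - snd p)); [ | simpl; lra].
      apply continuous_R_plus; [ | now apply continuous_R_opp].
      apply (continuous_R_comp ln).
      - apply continuous_R_mult; [apply continuous_const | ].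
        apply (continuous_R_comp cos); [exact Cf | apply continuity_cos].
      - apply continuity_pt_filterlim, continuous_ln; simpl; lra. }
    unfold locally', within; eapply filter_imp; [ | exact (filter_and _ _ B1 (filter_and _ _ B2 B3))].
    intros [t b] [K1 [K2 K3]] Hn; simpl in *; symmetry; apply closed_form_in; try lra.
    exact Hn.
  + intros Q HQ; unfold locally', within; eapply filter_imp; [ | exact HQ]; auto.
Qed.
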